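(* Let $\alpha,\kappa\ge0$, not both zero, and consider on $\mathcal{U}^\circ=\{(h,b)^\top: h>0,\ b>0\}$ the system $$h_t+\left(\alpha h^2b+\frac{\kappa h^3}{3}\right)_x=0,\qquad b_t+\left(\alpha hb^2+\frac{\kappa h^2b}{3}\right)_x=0.$$ Put $$w_1=\alpha hb+\frac{\kappa h^2}{3},\qquad w_2=\frac{b}{h},\qquad p=3\alpha w_2+\kappa .$$ Let $\Psi$ and $\Theta$ be arbitrary functions in $C^1(0,\infty)$. Then $$\eta[h,b]=\Psi(w_1)+\sqrt{w_1}\,\Theta(p),\qquad q[h,b]=3\left(w_1\Psi(w_1)-\int^{w_1}\Psi(s)\,ds\right)+(w_1)^{3/2}\,\Theta(p)$$ is an entropy/entropy-flux pair for the system in $\mathcal{U}^\circ$. Moreover, a sufficient condition for the entropy $\eta[h,b]$ to be strictly convex is that $\Psi$ (twice differentiable) and $\Theta$ satisfy $$\Psi''(w_1)>0,\qquad \Psi'(w_1)<0,\qquad 2w_1\Psi''(w_1)+\Psi'(w_1)>0,\qquad \Theta(p)=A\sqrt p+\frac{B}{\sqrt p},$$ for some arbitrary nonnegative constants $A$ and $B$.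
   Context: Writing the system as $\mathbf{U}_t+\mathbf{F}(\mathbf{U})_x=0$ with $\mathbf{U}=(h,b)^\top$, a pair $(\eta,q)$ of scalar functions on $\mathcal{U}^\circ$ is an entropy/entropy-flux pair if $\nabla q^\top=\nabla\eta^\top D\mathbf{F}(\mathbf{U})$, i.e. every smooth solution satisfies $\eta_t+q_x=0$. Here $\int^{w_1}\Psi(s)\,ds$ denotes any antiderivative of $\Psi$ on $(0,\infty)$ evaluated at $w_1$. Strict convexity of $\eta$ is with respect to the variables $(h,b)\in\mathcal{U}^\circ$ (positive definite Hessian $\nabla^2_{(h,b)}\eta$). The functions $w_1,w_2$ are the Riemann invariants of the system.
   Formalization: The strict convexity claim is stated only for α>0: for α=0 the entropy does not depend on b, so its Hessian is singular and the claim fails (e.g. Ψ(s)=s^(-1/4), A=B=0). The entropy-pair claim covers all α,κ≥0 not both zero. *)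

(* Defs.v *)
From Stdlib Require Import Reals.
From Coquelicot Require Import Coquelicot.
Open Scope R_scope.

Definition in_U (h b : R) : Prop := 0 < h /\ 0 < b.

Definition d_h (f : R -> R -> R) : R -> R -> R := partial_derive 1 0 f.
Definition d_b (f : R -> R -> R) : R -> R -> R := partial_derive 0 1 f.

Definition flux_h (alpha kappa h b : R) : R :=
  alpha * h ^ 2 * b + kappa * h ^ 3 / 3.
Definition flux_b (alpha kappa h b : R) : R :=
  alpha * h * b ^ 2 + kappa * h ^ 2 * b / 3.

(* The two equations are the components of grad q^T = grad eta^T DF, with
   F = (F1, F2).  Differentiability (not mere existence of the partial
   derivatives) makes this imply eta_t + q_x = 0 along smooth solutions. *)
Definition entropy_pair (F1 F2 eta q : R -> R -> R) : Prop :=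
  forall h b : R, in_U h b ->
    differentiable_pt eta h b /\
    differentiable_pt q h b /\
    d_h q h b = d_h eta h b * d_h F1 h b + d_b eta h b * d_h F2 h b /\
    d_b q h b = d_h eta h b * d_b F1 h b + d_b eta h b * d_b F2 h b.

Definition twice_differentiable_pt (f : R -> R -> R) (h b : R) : Prop :=
  differentiable_pt f h b /\
  differentiable_pt (d_h f) h b /\
  differentiable_pt (d_b f) h b.

Definition hessian_pos_def (f : R -> R -> R) (h b : R) : Prop :=
  forall u v : R, (u, v) <> (0, 0) ->
    0 < u * u * d_h (d_h f) h b + u * v * d_b (d_h f) h b
        + v * u * d_h (d_b f) h b + v * v * d_b (d_b f) h b.

(* Strict convexity in the differential sense: positive definite Hessian. *)
Definition strictly_convex_on_U (eta : R -> R -> R) : Prop :=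
  forall h b : R, in_U h b ->
    twice_differentiable_pt eta h b /\ hessian_pos_def eta h b.

Definition C1_pos (f : R -> R) : Prop :=
  forall s : R, 0 < s -> ex_derive f s /\ continuous (Derive f) s.

Definition antiderivative_pos (G f : R -> R) : Prop :=
  forall s : R, 0 < s -> is_derive G s (f s).

Definition w1 (alpha kappa h b : R) : R := alpha * h * b + kappa * h ^ 2 / 3.
Definition w2 (h b : R) : R := b / h.
Definition p (alpha kappa h b : R) : R := 3 * alpha * w2 h b + kappa.

Definition entropy (alpha kappa : R) (Psi Theta : R -> R) (h b : R) : R :=
  Psi (w1 alpha kappa h b)
  + sqrt (w1 alpha kappa h b) * Theta (p alpha kappa h b).

(* G stands for the chosen antiderivative of Psi. *)
Definition entropy_flux (alpha kappa : R) (Psi Theta G : R -> R) (h b : R) : R :=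
  3 * (w1 alpha kappa h b * Psi (w1 alpha kappa h b) - G (w1 alpha kappa h b))
  + Rpower (w1 alpha kappa h b) (3 / 2) * Theta (p alpha kappa h b).

(* Main.v *)
Require Import Defs.
From Stdlib Require Import Reals Lra.
From Coquelicot Require Import Coquelicot.
Open Scope R_scope.

(** Both claims come from homogeneity.  Write [w] for the first Riemann
    invariant and [p = 3 alpha b / h + kappa].

    Entropy identity.  The flux is the radial field [F = (h w, b w)], where [w]
    is homogeneous of degree 2 and [p] of degree 0.  Hence, for every [eta],
      [grad eta . DF = w grad eta + (h eta_h + b eta_b) grad w],
    and Euler's relations [h w_h + b w_b = 2 w] and [h p_h + b p_b = 0] turn
    the radial derivative of [eta = Psi(w) + sqrt w Theta(p)] into
    [2 w Psi'(w) + sqrt w Theta(p)].  The resulting one-form is exactly [dq].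
    This is [radial_flux_entropy_gradient].

    Convexity.  Since [w = h^2 p / 3] and [h p = 3 alpha b + kappa h], the
    choice [Theta(p) = A sqrt p + B / sqrt p] makes [sqrt w Theta(p)] a linear
    function of [(h, b)] ([sqrt_w1_Theta_linear]), which does not contribute to
    the Hessian.  What remains is
      [D^2 (Psi o w) = Psi''(w) grad w grad w^T + Psi'(w) D^2 w],
    whose determinant is [- alpha^2 Psi'(w) (2 w Psi''(w) + Psi'(w))] and whose
    [(b, b)] entry is [alpha^2 h^2 Psi''(w)]; for [alpha > 0] both
    are positive under the stated conditions on [Psi]. *)

(** * Differentials of functions of two variables *)

Lemma differentiable_pt_lim_const (c x y : R) :
  differentiable_pt_lim (fun _ _ => c) x y 0 0.
Proof. apply differentiable_pt_lim_proj1_0, derivable_pt_lim_const. Qed.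

Lemma differentiable_pt_lim_fst (x y : R) :
  differentiable_pt_lim (fun u _ => u) x y 1 0.
Proof.
  apply (differentiable_pt_lim_proj1_0 (fun u => u)), derivable_pt_lim_id.
Qed.

Lemma differentiable_pt_lim_snd (x y : R) :
  differentiable_pt_lim (fun _ v => v) x y 0 1.
Proof.
  intros eps; apply locally_2d_forall; intros u v.
  replace (v - y - (0 * (u - x) + 1 * (v - y))) with 0 by ring.
  rewrite Rabs_R0; apply Rmult_le_pos; [left; apply cond_pos|].
  apply Rle_trans with (1 := Rabs_pos (u - x)), Rmax_l.
Qed.

Lemma differentiable_pt_lim_Rplus (x y : R) :
  differentiable_pt_lim Rplus x y 1 1.
Proof.
  intros eps; apply locally_2d_forall; intros u v.
  replace (u + v - (x + y) - (1 * (u - x) + 1 * (v - y))) with 0 by ring.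
  rewrite Rabs_R0; apply Rmult_le_pos; [left; apply cond_pos|].
  apply Rle_trans with (1 := Rabs_pos (u - x)), Rmax_l.
Qed.

(** The error in the linearization of the product is exactly
    [(u - x) (v - y)], so the radius [eps] itself works. *)
Lemma differentiable_pt_lim_Rmult (x y : R) :
  differentiable_pt_lim Rmult x y y x.
Proof.
  intros eps; exists eps; intros u v Hu Hv.
  replace (u * v - x * y - (y * (u - x) + x * (v - y)))
    with ((u - x) * (v - y)) by ring.
  rewrite Rabs_mult; apply Rmult_le_compat; try apply Rabs_pos.
  - now apply Rlt_le.
  - apply Rmax_r.
Qed.

(** The partial derivatives are given up to an equation, so that the value
    produced by the calculus rules can be replaced by the wanted one. *)
Lemma differentiable_pt_lim_eq (f : R -> R -> R) (x y lx ly lx' ly' : R) :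
  differentiable_pt_lim f x y lx ly -> lx = lx' -> ly = ly' ->
  differentiable_pt_lim f x y lx' ly'.
Proof. now intros H <- <-. Qed.

Lemma differentiable_pt_lim_plus (f g : R -> R -> R) (x y fx fy gx gy : R) :
  differentiable_pt_lim f x y fx fy -> differentiable_pt_lim g x y gx gy ->
  differentiable_pt_lim (fun u v => f u v + g u v) x y (fx + gx) (fy + gy).
Proof.
  intros Hf Hg.
  eapply differentiable_pt_lim_eq.
  - apply differentiable_pt_lim_comp with (f1 := Rplus); eauto.
    apply differentiable_pt_lim_Rplus.
  - ring.
  - ring.
Qed.

Lemma differentiable_pt_lim_mult (f g : R -> R -> R) (x y fx fy gx gy : R) :
  differentiable_pt_lim f x y fx fy -> differentiable_pt_lim g x y gx gy ->
  differentiable_pt_lim (fun u v => f u v * g u v) x y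
    (fx * g x y + f x y * gx) (fy * g x y + f x y * gy).
Proof.
  intros Hf Hg.
  eapply differentiable_pt_lim_eq.
  - apply differentiable_pt_lim_comp with (f1 := Rmult); eauto.
    apply differentiable_pt_lim_Rmult.
  - ring.
  - ring.
Qed.

Lemma differentiable_pt_lim_comp_1d
    (phi : R -> R) (f : R -> R -> R) (x y l fx fy : R) :
  is_derive phi (f x y) l -> differentiable_pt_lim f x y fx fy ->
  differentiable_pt_lim (fun u v => phi (f u v)) x y (l * fx) (l * fy).
Proof.
  intros Hphi Hf; apply is_derive_Reals in Hphi.
  eapply differentiable_pt_lim_eq.
  - apply (differentiable_pt_lim_comp (fun u _ => phi u) f f x y l 0 fx fy fx fy);
      trivial.
    now apply differentiable_pt_lim_proj1_0.
  - ring.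
  - ring.
Qed.

Lemma differentiable_pt_lim_partials (f : R -> R -> R) (x y lx ly : R) :
  differentiable_pt_lim f x y lx ly ->
  differentiable_pt f x y /\ d_h f x y = lx /\ d_b f x y = ly.
Proof.
  intros H; split.
  - now exists lx, ly.
  - exact (differentiable_pt_lim_unique _ _ _ _ _ H).
Qed.

Lemma locally_in_U (h b : R) : in_U h b -> locally_2d in_U h b.
Proof.
  intros [Hh Hb].
  exists (mkposreal _ (Rmin_pos _ _ Hh Hb)); simpl; intros u v Hu Hv.
  pose proof (Rmin_l h b); pose proof (Rmin_r h b).
  apply Rabs_def2 in Hu; apply Rabs_def2 in Hv; split; lra.
Qed.

Lemma differentiable_pt_lim_ext_U (f g : R -> R -> R) (h b lh lb : R) :
  (forall u v, in_U u v -> f u v = g u v) -> in_U h b ->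
  differentiable_pt_lim f h b lh lb -> differentiable_pt_lim g h b lh lb.
Proof.
  intros Hfg HU; apply differentiable_pt_lim_ext.
  destruct (locally_in_U h b HU) as [d Hd].
  exists d; intros u v Hu Hv; now apply Hfg, Hd.
Qed.

(** * Entropies of a radial flux with homogeneous Riemann invariants *)

Lemma Rpower_3_2 (s : R) : 0 < s -> Rpower s (3 / 2) = s * sqrt s.
Proof.
  intros Hs.
  replace (3 / 2) with (1 + / 2) by field.
  now rewrite Rpower_plus, Rpower_1, Rpower_sqrt.
Qed.

Lemma is_derive_Rpower_3_2 (s : R) :
  0 < s -> is_derive (fun t => Rpower t (3 / 2)) s (3 / 2 * sqrt s).
Proof.
  intros Hs; rewrite <- (Rpower_sqrt s Hs).
  replace (/ 2) with (3 / 2 - 1) by field.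
  now apply is_derive_Reals, derivable_pt_lim_power.
Qed.

(** The hypotheses on [h wh + b wb] and [h ph + b pb] are Euler's relations for
    degrees 2 and 0; [wh * h + w h b] and so on are the entries of the Jacobian
    of the flux [(h w, b w)]. *)
Lemma radial_flux_entropy_gradient
    (w p : R -> R -> R) (Psi Theta G : R -> R) (h b wh wb ph pb : R) :
  differentiable_pt_lim w h b wh wb -> differentiable_pt_lim p h b ph pb ->
  h * wh + b * wb = 2 * w h b -> h * ph + b * pb = 0 ->
  0 < w h b ->
  ex_derive Psi (w h b) -> ex_derive Theta (p h b) ->
  is_derive G (w h b) (Psi (w h b)) ->
  exists eh eb : R,
    differentiable_pt_lim
      (fun u v => Psi (w u v) + sqrt (w u v) * Theta (p u v)) h b eh eb /\
    differentiable_pt_lim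
      (fun u v => 3 * (w u v * Psi (w u v) - G (w u v))
                  + Rpower (w u v) (3 / 2) * Theta (p u v)) h b
      (eh * (w h b + h * wh) + eb * (b * wh))
      (eh * (h * wb) + eb * (w h b + b * wb)).
Proof.
  intros Dw Dp Ew Ep Hw [P HP] [T HT] HG.
  pose proof (sqrt_lt_R0 _ Hw) as Hs.
  pose proof (sqrt_sqrt _ (Rlt_le _ _ Hw)) as Hss.
  assert (Hsq : is_derive sqrt (w h b) (/ (2 * sqrt (w h b))))
    by now apply is_derive_Reals, derivable_pt_lim_sqrt.
  assert (DPsi := differentiable_pt_lim_comp_1d _ _ _ _ _ _ _ HP Dw).
  assert (DTheta := differentiable_pt_lim_comp_1d _ _ _ _ _ _ _ HT Dp).
  assert (Dsq := differentiable_pt_lim_comp_1d _ _ _ _ _ _ _ Hsq Dw).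
  assert (DG := differentiable_pt_lim_comp_1d _ _ _ _ _ _ _ HG Dw).
  assert (Dpow := differentiable_pt_lim_comp_1d _ _ _ _ _ _ _
                    (is_derive_Rpower_3_2 _ Hw) Dw).
  assert (Deta := differentiable_pt_lim_plus _ _ _ _ _ _ _ _ DPsi
                    (differentiable_pt_lim_mult _ _ _ _ _ _ _ _ Dsq DTheta)).
  assert (Dq :=
    differentiable_pt_lim_plus _ _ _ _ _ _ _ _
      (differentiable_pt_lim_mult _ _ _ _ _ _ _ _
         (differentiable_pt_lim_const 3 h b)
         (differentiable_pt_lim_plus _ _ _ _ _ _ _ _
            (differentiable_pt_lim_mult _ _ _ _ _ _ _ _ Dw DPsi)
            (differentiable_pt_lim_mult _ _ _ _ _ _ _ _
               (differentiable_pt_lim_const (-1) h b) DG)))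
      (differentiable_pt_lim_mult _ _ _ _ _ _ _ _ Dpow DTheta)).
  cbv beta in Deta, Dq.
  do 2 eexists; split; [exact Deta|].
  (* The radial derivative of the entropy, where Euler's relations enter. *)
  match type of Deta with differentiable_pt_lim _ _ _ ?x ?y =>
    set (eh := x) in *; set (eb := y) in * end.
  assert (Radial : h * eh + b * eb
                   = 2 * w h b * P + sqrt (w h b) * Theta (p h b)).
  { replace (h * eh + b * eb)
      with ((h * wh + b * wb) * (P + / (2 * sqrt (w h b)) * Theta (p h b))
            + (h * ph + b * pb) * (sqrt (w h b) * T))
      by (unfold eh, eb; ring).
    rewrite Ew, Ep; replace (2 * w h b) with (2 * (sqrt (w h b) * sqrt (w h b)))
      by now rewrite Hss.
    field; lra. }
  apply differentiable_pt_lim_ext with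
    (f1 := fun u v => 3 * (w u v * Psi (w u v) + -1 * G (w u v))
                      + Rpower (w u v) (3 / 2) * Theta (p u v)).
  { apply locally_2d_forall; intros; ring. }
  eapply differentiable_pt_lim_eq; [exact Dq| |].
  - replace (eh * (w h b + h * wh) + eb * (b * wh))
      with (w h b * eh + (h * eh + b * eb) * wh) by ring.
    rewrite Radial, Rpower_3_2 by assumption; unfold eh; clear - Hs Hss.
    generalize (Psi (w h b)) (Theta (p h b)); intros psi theta.
    generalize dependent (sqrt (w h b)); intros s Hs Hss.
    rewrite <- Hss; field; lra.
  - replace (eh * (h * wb) + eb * (w h b + b * wb))
      with (w h b * eb + (h * eh + b * eb) * wb) by ring.
    rewrite Radial, Rpower_3_2 by assumption; unfold eb; clear - Hs Hss.
    generalize (Psi (w h b)) (Theta (p h b)); intros psi theta.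
    generalize dependent (sqrt (w h b)); intros s Hs Hss.
    rewrite <- Hss; field; lra.
Qed.

(** * The Riemann invariants of the system *)

Section RiemannInvariants.

Variables alpha kappa : R.

Lemma differentiable_pt_lim_w1_h (h b : R) :
  differentiable_pt_lim (fun u v => alpha * v + 2 * kappa / 3 * u) h b
    (2 * kappa / 3) alpha.
Proof.
  eapply differentiable_pt_lim_eq.
  - apply differentiable_pt_lim_plus; apply differentiable_pt_lim_mult;
      first [apply differentiable_pt_lim_const | apply differentiable_pt_lim_fst
            | apply differentiable_pt_lim_snd].
  - cbv beta; ring.
  - cbv beta; ring.
Qed.

Lemma differentiable_pt_lim_w1_b (h b : R) :
  differentiable_pt_lim (fun u _ => alpha * u) h b alpha 0.
Proof.
  eapply differentiable_pt_lim_eq.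
  - apply differentiable_pt_lim_mult;
      [apply differentiable_pt_lim_const | apply differentiable_pt_lim_fst].
  - cbv beta; ring.
  - cbv beta; ring.
Qed.

Lemma differentiable_pt_lim_w1 (h b : R) :
  differentiable_pt_lim (w1 alpha kappa) h b
    (alpha * b + 2 * kappa / 3 * h) (alpha * h).
Proof.
  apply differentiable_pt_lim_ext with
    (f1 := fun u v => alpha * u * v + kappa / 3 * u * u).
  { apply locally_2d_forall; intros; unfold w1; field. }
  eapply differentiable_pt_lim_eq.
  - repeat first [ apply differentiable_pt_lim_plus
                 | apply differentiable_pt_lim_mult
                 | apply differentiable_pt_lim_const
                 | apply differentiable_pt_lim_fst
                 | apply differentiable_pt_lim_snd ].
  - cbv beta; field.
  - cbv beta; field.
Qed.

Lemma differentiable_pt_lim_p (h b : R) :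
  in_U h b ->
  differentiable_pt_lim (p alpha kappa) h b
    (- (3 * alpha * b / h ^ 2)) (3 * alpha / h).
Proof.
  intros [Hh Hb].
  assert (Hinv : is_derive Rinv h (- (1 / h ^ 2)))
    by (auto_derive; [lra | field; lra]).
  apply differentiable_pt_lim_ext with
    (f1 := fun u v => 3 * alpha * v * / u + kappa).
  { apply locally_2d_forall; intros; unfold p, w2, Rdiv; ring. }
  eapply differentiable_pt_lim_eq.
  - apply differentiable_pt_lim_plus; [|apply differentiable_pt_lim_const].
    apply differentiable_pt_lim_mult.
    + apply differentiable_pt_lim_mult;
        [apply differentiable_pt_lim_const | apply differentiable_pt_lim_snd].
    + apply (differentiable_pt_lim_comp_1d Rinv (fun u _ => u) h b _ 1 0 Hinv).
      apply differentiable_pt_lim_fst.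
  - cbv beta; field; lra.
  - cbv beta; field; lra.
Qed.

Lemma flux_h_radial (h b : R) : h * w1 alpha kappa h b = flux_h alpha kappa h b.
Proof. unfold flux_h, w1; field. Qed.

Lemma flux_b_radial (h b : R) : b * w1 alpha kappa h b = flux_b alpha kappa h b.
Proof. unfold flux_b, w1; field. Qed.

Lemma w1_eq_p (h b : R) :
  in_U h b -> w1 alpha kappa h b = h ^ 2 * (p alpha kappa h b / 3).
Proof. intros [Hh Hb]; unfold w1, p, w2; field; lra. Qed.

Hypothesis alpha_ge0 : 0 <= alpha.
Hypothesis kappa_ge0 : 0 <= kappa.
Hypothesis not_both_0 : ~ (alpha = 0 /\ kappa = 0).

Lemma p_pos (h b : R) : in_U h b -> 0 < p alpha kappa h b.
Proof.
  intros [Hh Hb]; unfold p, w2.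
  assert (Hr : 0 < b / h) by now apply Rdiv_lt_0_compat.
  destruct alpha_ge0 as [Ha|Ha]; [nra|].
  destruct kappa_ge0 as [Hk|Hk]; [nra|].
  now elim not_both_0.
Qed.

Lemma w1_pos (h b : R) : in_U h b -> 0 < w1 alpha kappa h b.
Proof.
  intros HU; rewrite w1_eq_p by assumption.
  pose proof (p_pos h b HU); destruct HU as [Hh _].
  apply Rmult_lt_0_compat; [now apply pow_lt | lra].
Qed.

Lemma entropy_pair_riemann (Psi Theta G : R -> R) :
  (forall s, 0 < s -> ex_derive Psi s) ->
  (forall s, 0 < s -> ex_derive Theta s) ->
  antiderivative_pos G Psi ->
  entropy_pair (flux_h alpha kappa) (flux_b alpha kappa)
    (entropy alpha kappa Psi Theta) (entropy_flux alpha kappa Psi Theta G).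
Proof.
  intros DPsi DTheta DG h b HU.
  pose proof (w1_pos h b HU) as Hw; pose proof (p_pos h b HU) as Hp.
  assert (Dw := differentiable_pt_lim_w1 h b).
  assert (DF1 := differentiable_pt_lim_ext _ _ h b _ _
    (locally_2d_forall _ h b flux_h_radial)
    (differentiable_pt_lim_mult _ _ _ _ _ _ _ _
       (differentiable_pt_lim_fst h b) Dw)).
  assert (DF2 := differentiable_pt_lim_ext _ _ h b _ _
    (locally_2d_forall _ h b flux_b_radial)
    (differentiable_pt_lim_mult _ _ _ _ _ _ _ _
       (differentiable_pt_lim_snd h b) Dw)).
  destruct (radial_flux_entropy_gradient _ _ Psi Theta G _ _ _ _ _ _
              Dw (differentiable_pt_lim_p h b HU))
    as (eh & eb & Deta & Dq); auto.
  - unfold w1; field.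
  - destruct HU; field; lra.
  - apply differentiable_pt_lim_partials in DF1 as (_ & -> & ->).
    apply differentiable_pt_lim_partials in DF2 as (_ & -> & ->).
    apply (differentiable_pt_lim_partials (entropy alpha kappa Psi Theta))
      in Deta as (Ceta & Eh & Eb).
    apply (differentiable_pt_lim_partials (entropy_flux alpha kappa Psi Theta G))
      in Dq as (Cq & Qh & Qb).
    rewrite Eh, Eb, Qh, Qb.
    repeat split; [exact Ceta | exact Cq | ring | ring].
Qed.

(** * Convexity *)

(** From [w1 = h^2 p / 3] the left-hand side is [h (A p + B) / sqrt 3], and
    [h p] is linear. *)
Lemma sqrt_w1_Theta_linear (A B h b : R) :
  in_U h b ->
  sqrt (w1 alpha kappa h b)
  * (A * sqrt (p alpha kappa h b) + B / sqrt (p alpha kappa h b))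
  = (A * kappa + B) / sqrt 3 * h + 3 * alpha * A / sqrt 3 * b.
Proof.
  intros HU; pose proof (p_pos h b HU) as Hp.
  pose proof (sqrt_lt_R0 _ Hp) as Hs.
  assert (H3 : 0 < sqrt 3) by (apply sqrt_lt_R0; lra).
  rewrite w1_eq_p by assumption.
  destruct HU as [Hh Hb].
  rewrite sqrt_mult, sqrt_pow2, sqrt_div by (try apply pow2_ge_0; lra).
  replace (h * (sqrt (p alpha kappa h b) / sqrt 3)
           * (A * sqrt (p alpha kappa h b) + B / sqrt (p alpha kappa h b)))
    with (h * (A * (sqrt (p alpha kappa h b) * sqrt (p alpha kappa h b)) + B)
          / sqrt 3) by (field; lra).
  rewrite sqrt_sqrt by lra.
  unfold p, w2; field; lra.
Qed.

End RiemannInvariants.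

(** A binary quadratic form is reduced to a sum of squares by completing the
    square in the second variable. *)
Lemma quadratic_form_pos (a11 a12 a22 u v : R) :
  0 < a22 -> 0 < a11 * a22 - a12 * a12 -> (u, v) <> (0, 0) ->
  0 < u * u * a11 + u * v * a12 + v * u * a12 + v * v * a22.
Proof.
  intros Ha Hdet Huv.
  apply Rmult_lt_reg_l with a22; [assumption|]; rewrite Rmult_0_r.
  replace (a22 * (u * u * a11 + u * v * a12 + v * u * a12 + v * v * a22))
    with ((a22 * v + a12 * u)² + (a11 * a22 - a12 * a12) * u²)
    by (unfold Rsqr; ring).
  destruct (Req_dec u 0) as [-> | Hu].
  - assert (Hv : v <> 0) by (intros ->; now apply Huv).
    rewrite Rsqr_0, !Rmult_0_r, !Rplus_0_r.
    apply Rsqr_pos_lt, Rmult_integral_contrapositive_currified; lra.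
  - apply Rplus_le_lt_0_compat; [apply Rle_0_sqr|].
    now apply Rmult_lt_0_compat; [|apply Rsqr_pos_lt].
Qed.

(** Since [in_U] is open, knowing the gradient throughout it determines the
    second derivatives. *)
Lemma strictly_convex_of_gradient
    (f gh gb : R -> R -> R) (a11 a12 a22 : R -> R -> R) :
  (forall h b, in_U h b -> differentiable_pt_lim f h b (gh h b) (gb h b)) ->
  (forall h b, in_U h b ->
     differentiable_pt_lim gh h b (a11 h b) (a12 h b)) ->
  (forall h b, in_U h b ->
     differentiable_pt_lim gb h b (a12 h b) (a22 h b)) ->
  (forall h b, in_U h b ->
     0 < a22 h b /\ 0 < a11 h b * a22 h b - a12 h b * a12 h b) ->
  strictly_convex_on_U f.
Proof.
  intros Df Dgh Dgb Hpos h b HU.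
  assert (Eh : forall u v, in_U u v -> gh u v = d_h f u v).
  { intros u v Huv; symmetry.
    apply (differentiable_pt_lim_partials _ _ _ _ _ (Df u v Huv)). }
  assert (Eb : forall u v, in_U u v -> gb u v = d_b f u v).
  { intros u v Huv; symmetry.
    apply (differentiable_pt_lim_partials _ _ _ _ _ (Df u v Huv)). }
  destruct (differentiable_pt_lim_partials _ _ _ _ _
              (differentiable_pt_lim_ext_U _ _ _ _ _ _ Eh HU (Dgh h b HU)))
    as (Ch & Ehh & Ehb).
  destruct (differentiable_pt_lim_partials _ _ _ _ _
              (differentiable_pt_lim_ext_U _ _ _ _ _ _ Eb HU (Dgb h b HU)))
    as (Cb & Ebh & Ebb).
  split.
  - repeat split; try assumption.
    apply (differentiable_pt_lim_partials _ _ _ _ _ (Df h b HU)).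
  - intros u v Huv; rewrite Ehh, Ehb, Ebh, Ebb.
    destruct (Hpos h b HU); now apply quadratic_form_pos.
Qed.

Lemma strictly_convex_Psi_w1_plus_linear
    (alpha kappa c1 c2 : R) (Psi : R -> R) (f : R -> R -> R) :
  0 < alpha -> 0 <= kappa ->
  (forall s, 0 < s -> ex_derive Psi s) ->
  (forall s, 0 < s -> ex_derive (Derive Psi) s) ->
  (forall h b, in_U h b -> let w := w1 alpha kappa h b in
     0 < Derive (Derive Psi) w /\ Derive Psi w < 0 /\
     0 < 2 * w * Derive (Derive Psi) w + Derive Psi w) ->
  (forall h b, in_U h b ->
     f h b = Psi (w1 alpha kappa h b) + (c1 * h + c2 * b)) ->
  strictly_convex_on_U f.
Proof.
  intros Ha Hk D1 D2 Hpos Hf.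
  assert (Hnz : ~ (alpha = 0 /\ kappa = 0)) by lra.
  assert (Hw : forall h b, in_U h b -> 0 < w1 alpha kappa h b)
    by (intros; apply w1_pos; trivial; lra).
  assert (DQ : forall h b, in_U h b ->
    differentiable_pt_lim (fun u v => Derive Psi (w1 alpha kappa u v)) h b
      (Derive (Derive Psi) (w1 alpha kappa h b)
       * (alpha * b + 2 * kappa / 3 * h))
      (Derive (Derive Psi) (w1 alpha kappa h b) * (alpha * h))).
  { intros h b HU; apply differentiable_pt_lim_comp_1d;
      [apply Derive_correct; auto | apply differentiable_pt_lim_w1]. }
  pose (P := fun h b => Derive (Derive Psi) (w1 alpha kappa h b)).
  pose (Q := fun h b => Derive Psi (w1 alpha kappa h b)).
  pose (wh := fun h b : R => alpha * b + 2 * kappa / 3 * h).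
  apply strictly_convex_of_gradient with
    (gh := fun h b => Q h b * wh h b + c1)
    (gb := fun h b => Q h b * (alpha * h) + c2)
    (a11 := fun h b => P h b * wh h b * wh h b + Q h b * (2 * kappa / 3))
    (a12 := fun h b => P h b * (alpha * h) * wh h b + Q h b * alpha)
    (a22 := fun h b => P h b * (alpha * h) * (alpha * h));
    intros h b HU.
  - apply differentiable_pt_lim_ext_U with
      (f := fun u v => Psi (w1 alpha kappa u v) + (c1 * u + c2 * v));
      [now intros; symmetry; apply Hf | assumption |].
    eapply differentiable_pt_lim_eq.
    + apply differentiable_pt_lim_plus.
      * apply differentiable_pt_lim_comp_1d;
          [apply Derive_correct; auto | apply differentiable_pt_lim_w1].
      * apply differentiable_pt_lim_plus; apply differentiable_pt_lim_mult;
          first [ apply differentiable_pt_lim_const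
                | apply differentiable_pt_lim_fst
                | apply differentiable_pt_lim_snd ].
    + unfold Q, wh; ring.
    + unfold Q; ring.
  - eapply differentiable_pt_lim_eq.
    + apply differentiable_pt_lim_plus;
        [|apply differentiable_pt_lim_const].
      apply differentiable_pt_lim_mult;
        [now apply DQ | apply differentiable_pt_lim_w1_h].
    + unfold P, Q, wh; ring.
    + unfold P, Q, wh; ring.
  - eapply differentiable_pt_lim_eq.
    + apply differentiable_pt_lim_plus;
        [|apply differentiable_pt_lim_const].
      apply differentiable_pt_lim_mult;
        [now apply DQ | apply differentiable_pt_lim_w1_b].
    + unfold P, Q, wh; ring.
    + unfold P, Q, wh; ring.
  - destruct (Hpos h b HU) as (HP & HQ & HPQ); fold (P h b) (Q h b) in *.
    destruct HU as [Hh Hb].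
    assert (Hah : 0 < alpha * h) by now apply Rmult_lt_0_compat.
    split; [now repeat apply Rmult_lt_0_compat|].
    (* The Hessian determinant factors because [w1] is quadratic:
       [2 h w_h - 2 kappa h^2 / 3 = 2 w1]. *)
    match goal with |- 0 < ?d =>
      replace d with (alpha * alpha * (- Q h b)
                      * (2 * w1 alpha kappa h b * P h b + Q h b))
        by (unfold wh, w1; field) end.
    repeat apply Rmult_lt_0_compat; lra.
Qed.

(* In the convexity part alpha must be positive: for alpha = 0 the entropy does
   not depend on b, so its Hessian is singular. *)
Theorem theorem3p2 :
  forall (alpha kappa : R) (Psi Theta : R -> R),
    0 <= alpha -> 0 <= kappa -> ~ (alpha = 0 /\ kappa = 0) ->
    C1_pos Psi -> C1_pos Theta ->
    (forall G : R -> R, antiderivative_pos G Psi ->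
       entropy_pair (flux_h alpha kappa) (flux_b alpha kappa)
         (entropy alpha kappa Psi Theta)
         (entropy_flux alpha kappa Psi Theta G))
    /\
    (0 < alpha ->
     forall A B : R, 0 <= A -> 0 <= B ->
       (forall s : R, 0 < s -> ex_derive_n Psi 2 s) ->
       (forall h b : R, in_U h b ->
          0 < Derive_n Psi 2 (w1 alpha kappa h b) /\
          Derive Psi (w1 alpha kappa h b) < 0 /\
          0 < 2 * w1 alpha kappa h b * Derive_n Psi 2 (w1 alpha kappa h b)
              + Derive Psi (w1 alpha kappa h b) /\
          Theta (p alpha kappa h b)
          = A * sqrt (p alpha kappa h b) + B / sqrt (p alpha kappa h b)) ->
       strictly_convex_on_U (entropy alpha kappa Psi Theta)).
Proof.
  intros alpha kappa Psi Theta Ha Hk Hnz HPsi HTheta; split.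
  - intros G HG; apply entropy_pair_riemann; trivial.
    + intros s Hs; now apply HPsi.
    + intros s Hs; now apply HTheta.
  - intros Ha' A B _ _ HPsi2 Hpos.
    apply strictly_convex_Psi_w1_plus_linear with
      (alpha := alpha) (kappa := kappa) (Psi := Psi)
      (c1 := (A * kappa + B) / sqrt 3) (c2 := 3 * alpha * A / sqrt 3);
      trivial.
    + intros s Hs; now apply HPsi.
    + intros h b HU; destruct (Hpos h b HU) as (HP & HQ & HPQ & _); auto.
    + intros h b HU; destruct (Hpos h b HU) as (_ & _ & _ & HT).
      unfold entropy; rewrite HT, sqrt_w1_Theta_linear by trivial.
      reflexivity.
Qed.
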